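(* Let $A,E\in\mathbb{C}^{n\times n}$, $B\in\mathbb{C}^{n\times m}$, $C\in\mathbb{C}^{p\times n}$, $D\in\mathbb{C}^{p\times m}$ satisfy the standing assumptions in the context, let $\lambda_1$ be the dominant pole of the system $(A,E,B,C,D)$, and let $q$ be an integer with $q\ge 1$ if $m=p$ and $q\ge 2$ if $m\ne p$. Let $f$ be the function defined in the context. Suppose that $C\,\mathrm{adj}(\lambda_1E-A)\,B\neq 0$ and that the $2\times 2$ real Hessian $\nabla^2 f(\lambda_1)$ is invertible. Let $\beta>0$ be prescribed. Then there exist constants $\delta>0$ and $K>0$, depending only on $(A,E,B,C,D)$, $q$ and $\beta$, such that the following holds for every sequence $(\mu_\ell)$ with associated matrices $(V_\ell),(W_\ell)$ generated by the subspace framework described in the context, and every index $j\ge 1$. If 1. $|\mu_j-\lambda_1|\le\delta$ and $|\mu_{j+1}-\lambda_1|\le\delta$, 2. $\mu_j$ is not an eigenvalue of the pencil $L(s)=A-sE$, 3. $\mu_j$ is not a pole of the reduced transfer function $H_j$, that is, $\mu_jW_j^*EV_j-W_j^*AV_j$ is invertible, 4. $\|CV_j\,\mathrm{adj}(\mu_{j+1}W_j^*EV_j-W_j^*AV_j)\,W_j^*B\|_2\ge\beta$, then $$|\lambda_1-\mu_{j+1}|\;\le\;K\,|\lambda_1-\mu_j|^2 .$$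
   Context: Standing assumptions: $n\ge m$, $n\ge p$; the pencil $L(s)=A-sE$ is regular ($\det L(s)\not\equiv 0$) and its finite eigenvalues are simple; if $E$ is singular, then $0$ is a semisimple eigenvalue of the pencil $E-sA$ (index one). The transfer function is $H(s)=C(sE-A)^{-1}B+D$. Dominant pole: the poles of the system $(A,E,B,C,D)$ are the finite eigenvalues $\lambda_i$ of $A-sE$. For each of them let $v_i,w_i$ be right and left eigenvectors normalized by $w_i^*Ev_i=1$. The dominant pole is the eigenvalue $\lambda_i$ that maximizes $\|Cv_i\|_2\|w_i^*B\|_2/|\mathrm{Re}\,\lambda_i|$ (any maximizer in case of ties). The same definition is used for reduced systems, with their own matrices; these quantities are assumed to be well defined. Reduced system: for matrices $V,W\in\mathbb{C}^{n\times d}$ with orthonormal columns, the reduced system is $(W^*AV,\,W^*EV,\,W^*B,\,CV,\,D)$, with transfer function $CV(sW^*EV-W^*AV)^{-1}W^*B+D$. Subspace framework (for one dominant pole): start with $V_0,W_0$ having orthonormal columns and the same number of columns. For $\ell=1,2,\dots$: (i) $\mu_\ell$ is the dominant pole of the reduced system associated with $V_{\ell-1},W_{\ell-1}$; (ii) $V_\ell$ and $W_\ell$ are matrices whose columns are orthonormal bases of $\mathrm{Ran}(V_{\ell-1})+\mathcal{V}_{\mu_\ell}$ and $\mathrm{Ran}(W_{\ell-1})+\mathcal{W}_{\mu_\ell}$, where for $\mu$ not an eigenvalue of $A-sE$ $$\mathcal{V}_\mu=\sum_{i=0}^{q}\mathrm{Ran}\Big[\big((A-\mu E)^{-1}E\big)^i(A-\mu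 E)^{-1}B\,P_R(\mu)\Big],$$ $$\mathcal{W}_\mu=\sum_{i=0}^{q}\mathrm{Ran}\Big[\Big(C(A-\mu E)^{-1}\big(E(A-\mu E)^{-1}\big)^i\Big)^*P_L(\mu)\Big],$$ with $P_R(\mu)=I_m$ if $m\le p$ and $P_R(\mu)=H(\mu)^*$ if $m>p$; $P_L(\mu)=I_p$ if $p\le m$ and $P_L(\mu)=H(\mu)$ if $p>m$. It is assumed that $V_\ell$ and $W_\ell$ have the same number of columns for every $\ell$, so that the reduced pencils are square. No stopping tolerance is applied. $H_j$ denotes the transfer function of the reduced system associated with $V_j,W_j$. The function $f$ is $$f(s)=\frac{|\det(sE-A)|^2}{\|C\,\mathrm{adj}(sE-A)\,B\|_F^2},$$ where $\mathrm{adj}$ is the adjugate and $\|\cdot\|_F$ the Frobenius norm. It is regarded as a real function of $(\mathrm{Re}\,s,\mathrm{Im}\,s)$, defined wherever the denominator is nonzero, and $\nabla^2 f$ is its Hessian with respect to $(\mathrm{Re}\,s,\mathrm{Im}\,s)$. *)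

(* Defs.v *)
From mathcomp Require Import all_boot all_order all_algebra.
From mathcomp Require Export spectral complex.
From mathcomp Require Import all_classical all_reals all_analysis.
Import Order.TTheory GRing.Theory Num.Theory.
Import numFieldNormedType.Exports.

Set Implicit Arguments.
Unset Strict Implicit.
Unset Printing Implicit Defensive.

Local Open Scope ring_scope.
Local Open Scope complex_scope.
Local Open Scope sesquilinear_scope.

Section Norms.
Variable R : realType.

(* Real-valued modulus: the structural norm `|z| of R[i] takes values in R[i]. *)
Definition cmod (z : R[i]) : R := ComplexField.Normc.normc z.

(* On row and column vectors this is the Euclidean norm. *)
Definition frobenius_norm k l (M : 'M[R[i]]_(k, l)) : R :=
  Num.sqrt (\sum_(i < k) \sum_(j < l) cmod (M i j) ^+ 2).

(* ||M||_2, the operator norm induced by the Euclidean norms. *)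
Definition spectral_norm k l (M : 'M[R[i]]_(k, l)) : R :=
  sup [set frobenius_norm (M *m x) | x in
        [set x : 'cV[R[i]]_l | frobenius_norm x <= 1]]%classic.

End Norms.

Section Pencils.
Variables (R : realType) (n : nat).
Implicit Types (A E : 'M[R[i]]_n) (z : R[i]).

(* det (A - s E) as a polynomial in s *)
Definition pencil_poly A E : {poly R[i]} :=
  \det (map_mx polyC A - 'X *: map_mx polyC E).

Definition regular_pencil A E : Prop := pencil_poly A E != 0.

Definition pencil_eigenvalue A E z : Prop := \det (A - z *: E) = 0.

Definition simple_eigenvalue A E z : Prop :=
  pencil_eigenvalue A E z /\ mup z (pencil_poly A E) = 1%N.

(* algebraic multiplicity = geometric multiplicity *)
Definition semisimple_eigenvalue A E z : Prop :=
  pencil_eigenvalue A E z /\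
  mup z (pencil_poly A E) = \rank (kermx (A - z *: E)).

Definition standing_assumptions A E : Prop :=
  [/\ regular_pencil A E,
      forall z, pencil_eigenvalue A E z -> simple_eigenvalue A E z &
      \det E = 0 -> semisimple_eigenvalue E A 0].

Definition normalized_eigenvectors A E z (v w : 'cV[R[i]]_n) : Prop :=
  [/\ (A - z *: E) *m v = 0, w ^t* *m (A - z *: E) = 0 &
      w ^t* *m E *m v = 1%:M].

End Pencils.

Section DominantPole.
Variables (R : realType) (n m p : nat).
Variables (A E : 'M[R[i]]_n) (B : 'M[R[i]]_(n, m)) (C : 'M[R[i]]_(p, n)).

(* x is the value of ||C v|| ||w^* B|| / |Re z| for normalized eigenvectors;
   it is well defined when such eigenvectors exist, they all give the same
   value, and z is not on the imaginary axis. *)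
Definition is_dominance (z : R[i]) (x : R) : Prop :=
  [/\ complex.Re z != 0,
      exists v w, normalized_eigenvectors A E z v w &
      forall v w, normalized_eigenvectors A E z v w ->
        x = frobenius_norm (C *m v) * frobenius_norm (w ^t* *m B)
              / `|complex.Re z|].

(* The first clause rules out singular pencils, for which every z (0 included)
   satisfies pencil_eigenvalue. *)
Definition dominant_pole (z : R[i]) : Prop :=
  [/\ forall z', pencil_eigenvalue A E z' -> exists x, is_dominance z' x,
      pencil_eigenvalue A E z &
      forall z' x x', pencil_eigenvalue A E z' ->
        is_dominance z x -> is_dominance z' x' -> x' <= x].

End DominantPole.

Section Framework.
Variables (R : realType) (n m p : nat).
Variables (A E : 'M[R[i]]_n) (B : 'M[R[i]]_(n, m)).
Variables (C : 'M[R[i]]_(p, n)) (D : 'M[R[i]]_(p, m)).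

Definition transfer (s : R[i]) : 'M[R[i]]_(p, m) :=
  C *m invmx (s *: E - A) *m B + D.

Definition resolvent (mu : R[i]) : 'M[R[i]]_n := invmx (A - mu *: E).

(* Subspaces of column vectors are represented, as in mxalgebra, by row spaces;
   Ran X is thus the row space of X^T (plain transpose), and <<X^T>> is a
   square matrix with that row space. *)
Definition right_sum (q : nat) (mu : R[i]) k (P : 'M[R[i]]_(m, k)) : 'M[R[i]]_n :=
  (\sum_(i < q.+1)
     <<((resolvent mu *m E) ^+ i *m resolvent mu *m B *m P)^T>>)%MS.

Definition left_sum (q : nat) (mu : R[i]) k (P : 'M[R[i]]_(p, k)) : 'M[R[i]]_n :=
  (\sum_(i < q.+1)
     <<((C *m resolvent mu *m (E *m resolvent mu) ^+ i) ^t* *m P)^T>>)%MS.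

Definition right_space (q : nat) (mu : R[i]) : 'M[R[i]]_n :=
  if (m <= p)%N then right_sum q mu 1%:M
  else right_sum q mu ((transfer mu) ^t*).

Definition left_space (q : nat) (mu : R[i]) : 'M[R[i]]_n :=
  if (p <= m)%N then left_sum q mu 1%:M
  else left_sum q mu (transfer mu).

Definition orthonormal_columns k (V : 'M[R[i]]_(n, k)) : Prop :=
  V ^t* *m V = 1%:M.

(* mu 0 is irrelevant.  The interpolation spaces are defined only when the
   point is not an eigenvalue of A - s E, so the expansion of the bases is
   prescribed only in that case. *)
Definition subspace_framework (q : nat) (mu : nat -> R[i]) (d : nat -> nat)
    (V W : forall l, 'M[R[i]]_(n, d l)) : Prop :=
  (forall l, orthonormal_columns (V l) /\ orthonormal_columns (W l)) /\
  forall l,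
    dominant_pole ((W l) ^t* *m A *m V l) ((W l) ^t* *m E *m V l)
                  ((W l) ^t* *m B) (C *m V l) (mu l.+1) /\
    (~ pencil_eigenvalue A E (mu l.+1) ->
     ((V l.+1)^T == (V l)^T + right_space q (mu l.+1))%MS /\
     ((W l.+1)^T == (W l)^T + left_space q (mu l.+1))%MS).

End Framework.

Section Objective.
Variables (R : realType) (n m p : nat).
Variables (A E : 'M[R[i]]_n) (B : 'M[R[i]]_(n, m)) (C : 'M[R[i]]_(p, n)).

(* C identified with R^2 through (Re, Im) *)
Definition plane_of_complex (z : R[i]) : 'rV[R]_2 :=
  \row_(i < 2) (if i == 0 then complex.Re z else complex.Im z).

Definition complex_of_plane (x : 'rV[R]_2) : R[i] := x 0 0 +i* x 0 1.

Definition objective (x : 'rV[R]_2) : R :=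
  let s := complex_of_plane x in
  cmod (\det (s *: E - A)) ^+ 2
    / frobenius_norm (C *m \adj (s *: E - A) *m B) ^+ 2.

End Objective.

Definition hessian (R : realType) (f : 'rV[R]_2 -> R) (x : 'rV[R]_2) : 'M[R]_2 :=
  \matrix_(i < 2, j < 2)
    'D_(delta_mx 0 j) (fun y => 'D_(delta_mx 0 i) f y) x.

(* Main.v *)
Require Import Defs.
From mathcomp Require Import all_boot all_order all_algebra perm lra.
From mathcomp Require Import all_classical all_reals all_analysis.
Import Order.TTheory GRing.Theory Num.Theory.
Import numFieldNormedType.Exports.
Set Implicit Arguments.
Unset Strict Implicit.
Unset Printing Implicit Defensive.
Local Open Scope ring_scope.
Local Open Scope complex_scope.
Local Open Scope sesquilinear_scope.

(** Put [K(s) = sE - A], [N(s) = C adj(K(s)) B], and write [K_j], [N_j] for the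
    reduced system.  The one-sided moments of order 0 and 1 contained in [V_j]
    (if [m <= p]) or in [W_j] (if [p < m]) already give Hermite interpolation, so
    the polynomial matrix [det K * N_j - det K_j * N] is divisible by
    [(s - mu_j)^2].  Expanded around [mu_j], its coefficients are bounded
    independently of the reduced system, because the bases are orthonormal.
    At [s = mu_{j+1}] one has [det K_j = 0], hence
    [|det K(mu_{j+1})| * beta <= L |mu_{j+1} - mu_j|^2], while simplicity of
    [lambda1] gives [|det K(mu_{j+1})| >= c |mu_{j+1} - lambda1|]; for small
    [delta] the term [|mu_{j+1} - lambda1|^2] coming from the triangle inequality
    is absorbed by the left-hand side. *)

(** * Hermite interpolation by projected pencils *)

Section Interpolation.
Variable F : comNzRingType.

(** The hypotheses give [(K + t *: E) *m (X - t *: Y) = B - t ^+ 2 *: (E *m Y)]; multiply by the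
    adjugate. No pencil is inverted, so [t] may later be the indeterminate. *)
Lemma adj_pencil_expansion n m (t : F) (K E : 'M[F]_n) (B X Y : 'M[F]_(n, m)) :
    K *m X = B -> K *m Y = E *m X ->
  \adj (K + t *: E) *m B =
    \det (K + t *: E) *: (X - t *: Y)
    + t ^+ 2 *: (\adj (K + t *: E) *m E *m Y).
Proof.
move=> hX hY; rewrite -[_ *: (X - _)]mul_scalar_mx -mul_adj_mx -!mulmxA.
rewrite [t ^+ 2 *: _]scalemxAr -mulmxDr.
congr (_ *m _); rewrite mulmxBr -!scalemxAr !mulmxDl -!scalemxAl hX hY.
by rewrite scalerDr scalerA -expr2 opprD addrA addrK subrK.
Qed.

(** Projecting by [W] shows that [x], [y] solve the same two equations for the reduced pencil.
    Expanding both adjugates, each product contains [\det Ks * \det (W *m Ks *m V)] times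
    [C *m V *m (x - t *: y)]; these cancel and only multiples of [t ^+ 2] remain. *)
Lemma right_hermite n m p d (t : F) (K E : 'M[F]_n) (B : 'M[F]_(n, m))
    (C : 'M[F]_(p, n)) (V : 'M[F]_(n, d)) (W : 'M[F]_(d, n))
    (x y : 'M[F]_(d, m)) :
    K *m (V *m x) = B -> K *m (V *m y) = E *m (V *m x) ->
  let Ks := K + t *: E in
  exists Z, \det Ks *: (C *m V *m \adj (W *m Ks *m V) *m (W *m B))
            - \det (W *m Ks *m V) *: (C *m \adj Ks *m B) = t ^+ 2 *: Z.
Proof.
move=> hX hY Ks.
have -> : W *m Ks *m V = W *m K *m V + t *: (W *m E *m V).
  by rewrite mulmxDr mulmxDl -scalemxAr -scalemxAl.
set Kd := W *m K *m V; set Ed := W *m E *m V.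
have hx : Kd *m x = W *m B by rewrite -hX !mulmxA.
have hy : Kd *m y = Ed *m x.
  by rewrite /Kd /Ed -!mulmxA hY.
rewrite -!(mulmxA (_ *m _) (\adj _)) -(mulmxA C (\adj _)).
rewrite (adj_pencil_expansion t hx hy) (adj_pencil_expansion t hX hY).
rewrite -(mulmxA C V) [V *m (_ + _)]mulmxDr -![V *m (_ *: _)]scalemxAr mulmxBr.
rewrite -![V *m (_ *: _)]scalemxAr !mulmxDr -!scalemxAr !scalerDr !scalerA.
rewrite [\det (Kd + _) * \det _]mulrC opprD addrACA subrr add0r.
rewrite ![_ * t ^+ 2]mulrC -![(t ^+ 2 * _) *: _]scalerA -scalerBr.
by eexists; reflexivity.
Qed.

(** Transpose of [right_hermite], with [V] and [W] exchanged. *)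
Lemma left_hermite n m p d (t : F) (K E : 'M[F]_n) (B : 'M[F]_(n, m))
    (C : 'M[F]_(p, n)) (V : 'M[F]_(n, d)) (W : 'M[F]_(d, n))
    (x y : 'M[F]_(p, d)) :
    x *m W *m K = C -> y *m W *m K = x *m W *m E ->
  let Ks := K + t *: E in
  exists Z, \det Ks *: (C *m V *m \adj (W *m Ks *m V) *m (W *m B))
            - \det (W *m Ks *m V) *: (C *m \adj Ks *m B) = t ^+ 2 *: Z.
Proof.
move=> hX hY Ks.
have hx : K^T *m (W^T *m x^T) = C^T by rewrite -!trmx_mul hX.
have hy : K^T *m (W^T *m y^T) = E^T *m (W^T *m x^T) by rewrite -!trmx_mul hY.
have [Z] := right_hermite t B^T V^T hx hy.
have -> : K^T + t *: E^T = Ks^T by rewrite linearD linearZ.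
have -> : V^T *m Ks^T *m W^T = (W *m Ks *m V)^T by rewrite !trmx_mul mulmxA.
rewrite !det_tr -!trmx_adj -!trmx_mul => /(congr1 trmx).
rewrite linearB !linearZ /= !trmxK !mulmxA => ->; by exists Z^T.
Qed.

End Interpolation.

(** * The l1 norm of coefficients *)

Section CoefficientNorm.
Variable F : numDomainType.
Implicit Types p q : {poly F}.

(** This norm is submultiplicative and dominates the values on the closed unit disc, so products,
    determinants and evaluations are bounded by explicit constants. *)
Definition coef_norm p : F := \sum_(i < size p) `|p`_i|.

Lemma coef_normE n p : (size p <= n)%N -> coef_norm p = \sum_(i < n) `|p`_i|.
Proof.
move=> hn; rewrite /coef_norm (big_ord_widen n (fun i => `|p`_i|) hn) big_mkcond.
by apply: eq_bigr => i _; case: ltnP => // /(nth_default 0) ->; rewrite normr0.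
Qed.

Lemma coef_norm_ge0 p : 0 <= coef_norm p. Proof. exact: sumr_ge0. Qed.

Lemma coef_normD p q : coef_norm (p + q) <= coef_norm p + coef_norm q.
Proof.
rewrite !(@coef_normE (maxn (size p) (size q))) ?leq_maxl ?leq_maxr ?size_polyD //.
by rewrite -big_split; apply: ler_sum => i _; rewrite coefD ler_normD.
Qed.

Lemma coef_normZ c p : coef_norm (c *: p) = `|c| * coef_norm p.
Proof.
rewrite (coef_normE (size_scale_leq c p)) mulr_sumr.
by apply: eq_bigr => i _; rewrite coefZ normrM.
Qed.

Lemma coef_normN p : coef_norm (- p) = coef_norm p.
Proof. by rewrite -scaleN1r coef_normZ normrN1 mul1r. Qed.

Lemma coef_norm_MXaddC p c : coef_norm (p * 'X + c%:P) = coef_norm p + `|c|.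
Proof.
rewrite (@coef_normE (size p).+1); last first.
  by rewrite size_MXaddC; case: ifP.
rewrite big_ord_recl addrC coefD coefMX coefC /= add0r; congr (_ + _).
by apply: eq_bigr => i _; rewrite coefD coefMX coefC /= addr0.
Qed.

Lemma coef_normMX p : coef_norm (p * 'X) = coef_norm p.
Proof. by rewrite -[p * 'X]addr0 -polyC0 coef_norm_MXaddC normr0 addr0. Qed.

Lemma coef_normC c : coef_norm c%:P = `|c|.
Proof.
by rewrite -[c%:P]add0r -{1}(mul0r 'X) coef_norm_MXaddC /coef_norm size_poly0 big_ord0 add0r.
Qed.

(** Induction along the Horner scheme: [(p * 'X + c) * q] is the shift of [p * q] plus [c *: q], and
    a shift preserves the norm. *)
Lemma coef_normM p q : coef_norm (p * q) <= coef_norm p * coef_norm q.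
Proof.
elim/poly_ind: p => [|p c IH].
  by rewrite mul0r /coef_norm size_poly0 !big_ord0 mul0r.
rewrite coef_norm_MXaddC !mulrDl -mulrA -commr_polyX mulrA.
apply: le_trans (coef_normD _ _) _.
by rewrite coef_normMX mul_polyC coef_normZ lerD2r.
Qed.

Lemma coef_norm_sum (I : Type) (r : seq I) (P : pred I) (f : I -> {poly F}) :
  coef_norm (\sum_(i <- r | P i) f i) <= \sum_(i <- r | P i) coef_norm (f i).
Proof.
elim/big_rec2: _ => [|i y x _ IH]; first by rewrite coef_normC normr0.
by apply: le_trans (coef_normD _ _) _; rewrite lerD2l.
Qed.

Lemma coef_norm_prod (I : Type) (r : seq I) (P : pred I) (f : I -> {poly F}) :
  coef_norm (\prod_(i <- r | P i) f i) <= \prod_(i <- r | P i) coef_norm (f i).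
Proof.
elim/big_rec2: _ => [|i y x _ IH]; first by rewrite coef_normC normr1.
apply: le_trans (coef_normM _ _) _.
by rewrite ler_wpM2l ?coef_norm_ge0.
Qed.

Lemma coef_norm_horner p (t : F) : `|t| <= 1 -> `|p.[t]| <= coef_norm p.
Proof.
move=> ht; rewrite horner_coef; apply: le_trans (ler_norm_sum _ _ _) _.
apply: ler_sum => i _; rewrite normrM normrX ler_piMr //.
exact: exprn_ile1.
Qed.

End CoefficientNorm.

(** * Coefficient norms of polynomial matrices, their determinants and adjugates *)

Section MatrixCoefficientNorm.
Variable F : numDomainType.

Definition mx_coef_norm k l (M : 'M[{poly F}]_(k, l)) : F :=
  \sum_i \sum_j coef_norm (M i j).

Lemma mx_coef_norm_ge0 k l (M : 'M[{poly F}]_(k, l)) : 0 <= mx_coef_norm M.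
Proof. by do 2!(apply: sumr_ge0 => ? _); exact: coef_norm_ge0. Qed.

Lemma coef_norm_entry k l (M : 'M[{poly F}]_(k, l)) i j :
  coef_norm (M i j) <= mx_coef_norm M.
Proof.
rewrite /mx_coef_norm (bigD1 i) //= (bigD1 j) //= -addrA lerDl addr_ge0 //.
  by apply: sumr_ge0 => ? _; exact: coef_norm_ge0.
by do 2!(apply: sumr_ge0 => ? _); exact: coef_norm_ge0.
Qed.

Lemma mx_coef_normD k l (M N : 'M[{poly F}]_(k, l)) :
  mx_coef_norm (M + N) <= mx_coef_norm M + mx_coef_norm N.
Proof.
rewrite /mx_coef_norm -big_split; apply: ler_sum => i _ /=.
rewrite -big_split; apply: ler_sum => j _ /=.
by rewrite mxE coef_normD.
Qed.

Lemma mx_coef_normN k l (M : 'M[{poly F}]_(k, l)) :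
  mx_coef_norm (- M) = mx_coef_norm M.
Proof. by do 2!(apply: eq_bigr => ? _); rewrite mxE coef_normN. Qed.

Lemma mx_coef_normZ k l a (M : 'M[{poly F}]_(k, l)) :
  mx_coef_norm (a *: M) <= coef_norm a * mx_coef_norm M.
Proof.
rewrite /mx_coef_norm mulr_sumr; apply: ler_sum => i _.
by rewrite mulr_sumr; apply: ler_sum => j _; rewrite mxE coef_normM.
Qed.

Lemma mx_coef_normM k l m (M : 'M[{poly F}]_(k, l)) (N : 'M[{poly F}]_(l, m)) :
  mx_coef_norm (M *m N) <= mx_coef_norm M * mx_coef_norm N.
Proof.
rewrite {1 2}/mx_coef_norm mulr_suml; apply: ler_sum => i _.
apply: (@le_trans _ _ (\sum_j \sum_k coef_norm (M i k) * coef_norm (N k j))).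
  apply: ler_sum => j _; rewrite mxE; apply: le_trans (coef_norm_sum _ _ _) _.
  by apply: ler_sum => h _; exact: coef_normM.
rewrite exchange_big mulr_suml /=; apply: ler_sum => h _.
rewrite -mulr_sumr ler_wpM2l ?coef_norm_ge0 //.
rewrite /mx_coef_norm (bigD1 h) //= lerDl.
by do 2!(apply: sumr_ge0 => ? _); exact: coef_norm_ge0.
Qed.

(** Leibniz formula: [n!] signed products of [n] entries each. *)
Lemma coef_norm_det n (M : 'M[{poly F}]_n) b :
  (forall i j, coef_norm (M i j) <= b) -> coef_norm (\det M) <= n`!%:R * b ^+ n.
Proof.
move=> hb; apply: le_trans (coef_norm_sum _ _ _) _.
rewrite -card_Sn -sum1_card natr_sum mulr_suml.
apply: ler_sum => s _; rewrite mul1r.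
apply: le_trans (coef_normM _ _) _.
rewrite -signr_odd -polyC1 -polyCN -polyC_exp coef_normC normrX normrN1 expr1n mul1r.
apply: le_trans (coef_norm_prod _ _ _) _.
rewrite -[n in b ^+ n]card_ord -prodr_const; apply: ler_prod => i _.
by rewrite coef_norm_ge0 hb.
Qed.

(** The reduced dimension [d] varies along the iteration; [1 <= b] makes the bound monotone in the
    size, so that it depends on [n] alone. *)
Lemma coef_norm_det_le n d (M : 'M[{poly F}]_d) b : (d <= n)%N -> 1 <= b ->
  (forall i j, coef_norm (M i j) <= b) -> coef_norm (\det M) <= n`!%:R * b ^+ n.
Proof.
move=> hd hb hM; apply: le_trans (coef_norm_det hM) _.
have b0 : 0 <= b by apply: le_trans hb.
apply: ler_pM => //; rewrite ?exprn_ge0 //; last exact: ler_weXn2l.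
by rewrite ler_nat leq_fact.
Qed.

Lemma mx_coef_norm_adj n d (M : 'M[{poly F}]_d) b : (d <= n)%N -> 1 <= b ->
    (forall i j, coef_norm (M i j) <= b) ->
  mx_coef_norm (\adj M) <= n%:R ^+ 2 * (n`!%:R * b ^+ n).
Proof.
move=> hd hb hM; have b0 : 0 <= b by apply: le_trans hb.
have D0 : 0 <= n`!%:R * b ^+ n by rewrite mulr_ge0 ?exprn_ge0.
apply: (@le_trans _ _ (\sum_(i < d) \sum_(j < d) n`!%:R * b ^+ n)).
  apply: ler_sum => i _; apply: ler_sum => j _; rewrite mxE.
  apply: le_trans (coef_normM _ _) _.
  rewrite -signr_odd -polyC1 -polyCN -polyC_exp coef_normC normrX normrN1 expr1n mul1r.
  apply: coef_norm_det_le => //; first exact: leq_trans (leq_pred _) hd.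
  by move=> k l; rewrite !mxE.
rewrite sumr_const card_ord sumr_const card_ord -mulrnA -[_ *+ (d * d)]mulr_natl -natrX.
by apply: ler_wpM2r => //; rewrite ler_nat leq_mul.
Qed.

(** Multiplication by ['X^2] only shifts coefficients, so [Z] has the same norm as [M] and never
    needs a bound of its own. *)
Lemma mx_horner_vanishing k l (M Z : 'M[{poly F}]_(k, l)) (t : F) :
    M = 'X^2 *: Z -> `|t| <= 1 ->
  \sum_i \sum_j `|(M i j).[t]| <= `|t| ^+ 2 * mx_coef_norm M.
Proof.
move=> -> ht; rewrite /mx_coef_norm mulr_sumr; apply: ler_sum => i _.
rewrite mulr_sumr; apply: ler_sum => j _; rewrite mxE mulrC.
rewrite expr2 mulrA !coef_normMX !hornerM hornerX !normrM -mulrA mulrC expr2.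
by rewrite ler_wpM2l ?mulr_ge0 ?coef_norm_horner.
Qed.

End MatrixCoefficientNorm.

(** * Quantitative estimates *)

Section InterpolationBound.
Variable F : numFieldType.

Local Notation lift := (map_mx polyC).

Lemma lift_horner k l (M : 'M[F]_(k, l)) t : map_mx (horner_eval t) (lift M) = M.
Proof. by apply/matrixP => i j; rewrite !mxE /horner_eval hornerC. Qed.

Lemma mx_coef_norm_lift_le k l (M : 'M[F]_(k, l)) :
    (forall i j, `|M i j| <= 1) -> mx_coef_norm (lift M) <= (k * l)%:R.
Proof.
move=> hM; apply: (@le_trans _ _ (\sum_(i < k) \sum_(j < l) 1)).
  by do 2!(apply: ler_sum => ? _); rewrite mxE coef_normC.
by rewrite !sumr_const !card_ord -mulrnA mulnC.
Qed.

(** [L] is chosen before [d], [K], [V], [W] and [t], which is the required uniformity. The Hermite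
    identity is applied over polynomials with ['X] in place of [t], its coefficients are bounded,
    and only then is it evaluated at [t]. *)
Lemma hermite_defect_bound n m p (E : 'M[F]_n) (B : 'M[F]_(n, m))
    (C : 'M[F]_(p, n)) (k : F) : 0 <= k ->
  exists2 L : F, 0 <= L &
  forall d (K : 'M[F]_n) (V : 'M[F]_(n, d)) (W : 'M[F]_(d, n)) (t : F),
    (d <= n)%N ->
    (forall i j, `|V i j| <= 1) -> (forall i j, `|W i j| <= 1) ->
    mx_coef_norm (lift K) <= k -> `|t| <= 1 ->
    (exists x y, K *m (V *m x) = B /\ K *m (V *m y) = E *m (V *m x)) \/
    (exists x y, x *m W *m K = C /\ y *m W *m K = x *m W *m E) ->
    let Ks := K + t *: E in
    \det (W *m Ks *m V) = 0 ->
    `|\det Ks|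
      * \sum_i \sum_j `|(C *m V *m \adj (W *m Ks *m V) *m (W *m B)) i j|
    <= `|t| ^+ 2 * L.
Proof.
move=> k0.
(* [v] bounds the norms of [V] and [W], [b] the entries of the full and reduced pencils (with an
   added 1 so that [1 <= b]), [D] their determinants and [a] their adjugates. *)
pose e := mx_coef_norm (lift E); pose bb := mx_coef_norm (lift B).
pose c := mx_coef_norm (lift C); pose v : F := (n * n)%:R.
pose b := 1 + (k + e) + v * (k + e) * v.
pose D := n`!%:R * b ^+ n; pose a := n%:R ^+ 2 * D.
have e0 : 0 <= e by exact: mx_coef_norm_ge0.
have bb0 : 0 <= bb by exact: mx_coef_norm_ge0.
have c0 : 0 <= c by exact: mx_coef_norm_ge0.
have v0 : 0 <= v by exact: ler0n.
have ke0 : 0 <= k + e by rewrite addr_ge0.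
have vkv0 : 0 <= v * (k + e) * v by rewrite !mulr_ge0.
have b1 : 1 <= b by rewrite /b -addrA lerDl addr_ge0.
have D0 : 0 <= D by rewrite mulr_ge0 ?exprn_ge0 ?(le_trans _ b1).
have a0 : 0 <= a by rewrite mulr_ge0 ?exprn_ge0.
exists (D * (c * v * a * (v * bb)) + D * (c * a * bb)).
  by do ?[assumption | apply: addr_ge0 | apply: mulr_ge0].
move=> d K V W t hd hV hW hK ht hxy Ks hdet.
pose KX := lift K + 'X *: lift E; pose Kd := lift W *m KX *m lift V.
pose P := \det KX *: (lift C *m lift V *m \adj Kd *m (lift W *m lift B))
          - \det Kd *: (lift C *m \adj KX *m lift B).
have [Z hZ] : exists Z, P = 'X^2 *: Z.
  case: hxy => -[x [y [hx hy]]].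
    apply: (@right_hermite _ _ _ _ _ 'X (lift K) (lift E) (lift B) (lift C)
      (lift V) (lift W) (lift x) (lift y)); by rewrite -!map_mxM ?hx ?hy.
  apply: (@left_hermite _ _ _ _ _ 'X (lift K) (lift E) (lift B) (lift C)
      (lift V) (lift W) (lift x) (lift y)); by rewrite -!map_mxM ?hx ?hy.
have hKX : map_mx (horner_eval t) KX = Ks.
  by apply/matrixP => i j; rewrite !mxE /horner_eval !hornerE.
have hKd : map_mx (horner_eval t) Kd = W *m Ks *m V.
  by rewrite !map_mxM hKX !lift_horner.
have nV : mx_coef_norm (lift V) <= v.
  by apply: le_trans (mx_coef_norm_lift_le hV) _; rewrite ler_nat leq_mul.
have nW : mx_coef_norm (lift W) <= v.
  by apply: le_trans (mx_coef_norm_lift_le hW) _; rewrite ler_nat leq_mul.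
have nKX : mx_coef_norm KX <= k + e.
  apply: le_trans (mx_coef_normD _ _) _; rewrite lerD //.
  apply: le_trans (mx_coef_normZ _ _) _.
  by rewrite -[X in coef_norm X]mul1r coef_normMX -polyC1 coef_normC normr1 mul1r.
have mulle k1 l1 m1 (M : 'M[{poly F}]_(k1, l1)) (N : 'M[{poly F}]_(l1, m1)) x y :
    mx_coef_norm M <= x -> mx_coef_norm N <= y -> mx_coef_norm (M *m N) <= x * y.
  move=> hM hN; apply: le_trans (mx_coef_normM _ _) _.
  by apply: ler_pM => //; exact: mx_coef_norm_ge0.
have nKd : mx_coef_norm Kd <= v * (k + e) * v by do 2!apply: (mulle) => //.
have eKX i j : coef_norm (KX i j) <= b.
  apply: le_trans (coef_norm_entry _ i j) _; apply: le_trans nKX _.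
  by rewrite /b addrAC lerDr addr_ge0.
have eKd i j : coef_norm (Kd i j) <= b.
  apply: le_trans (coef_norm_entry _ i j) _; apply: le_trans nKd _.
  by rewrite /b lerDr addr_ge0.
have aKd : mx_coef_norm (\adj Kd) <= a by exact: mx_coef_norm_adj.
have aKX : mx_coef_norm (\adj KX) <= a by exact: mx_coef_norm_adj.
have nP : mx_coef_norm P <= D * (c * v * a * (v * bb)) + D * (c * a * bb).
  apply: le_trans (mx_coef_normD _ _) _; rewrite mx_coef_normN lerD //.
    apply: le_trans (mx_coef_normZ _ _) _.
    apply: ler_pM; rewrite ?coef_norm_ge0 ?mx_coef_norm_ge0 //.
      exact: coef_norm_det_le.
    by do ?[assumption | exact: lexx | apply: (mulle)].
  apply: le_trans (mx_coef_normZ _ _) _.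
  apply: ler_pM; rewrite ?coef_norm_ge0 ?mx_coef_norm_ge0 //.
    exact: coef_norm_det_le.
  by do ?[assumption | exact: lexx | apply: (mulle)].
apply: (@le_trans _ _ (`|t| ^+ 2 * mx_coef_norm P)); last first.
  by rewrite ler_wpM2l ?exprn_ge0.
apply: le_trans (mx_horner_vanishing hZ ht).
rewrite mulr_sumr; apply: ler_sum => i _; rewrite mulr_sumr; apply: ler_sum => j _.
have -> : (P i j).[t] = (map_mx (horner_eval t) P) i j by rewrite [RHS]mxE.
(* At [t], the pencils become [Ks] and [W *m Ks *m V], and [hdet] kills the second term of [P]. *)
rewrite /P map_mxB !map_mxZ !map_mxM /= !map_mx_adj hKX hKd !lift_horner.
rewrite -/(horner_eval t (\det KX)) -/(horner_eval t (\det Kd)) -!det_map_mx.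
by rewrite hKX hKd hdet scale0r subr0 [in leRHS]mxE normrM.
Qed.

(** Write [f = g * ('X - z)] with [g.[z] != 0]; near [z], [g] keeps at least half of its modulus at
    [z]. *)
Lemma simple_root_lower_bound (f : {poly F}) z : f != 0 -> mup z f = 1%N ->
  exists c delta : F, [/\ 0 < c, 0 < delta &
    forall s, `|s - z| <= delta -> c * `|s - z| <= `|f.[s]|].
Proof.
move=> f0 hf.
have /dvdpP[g fg] : ('X - z%:P) ^+ 1 %| f by rewrite -mup_geq ?hf.
have gz : g.[z] != 0.
  apply/negP => /factor_theorem[h gh].
  have : (2 <= mup z f)%N by rewrite mup_geq // fg gh expr1 -mulrA -expr2 dvdp_mull.
  by rewrite hf.
have [h hh] : exists h, g - g.[z]%:P = h * ('X - z%:P).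
  by apply/factor_theorem; rewrite /root !hornerE subrr.
(* Recentring [h] at [z] makes [M] a bound for [h] on the unit disc around [z]. *)
pose M := coef_norm (h \Po ('X + z%:P)); pose G := `|g.[z]|.
have M0 : 0 <= M by exact: coef_norm_ge0.
have G0 : 0 < G by rewrite normr_gt0.
have GM : 0 < G + 2 * M by rewrite ltr_wpDr ?mulr_ge0.
(* This radius is at most 1, and [M] times it is at most [G / 2]. *)
exists (G / 2), (G / (G + 2 * M)); split; rewrite ?divr_gt0 // => s hs.
have s1 : `|s - z| <= 1.
  by apply: le_trans hs _; rewrite ler_pdivrMr // mul1r lerDl mulr_ge0.
have hM : `|h.[s]| <= M.
  by have := coef_norm_horner (h \Po ('X + z%:P)) s1; rewrite horner_comp !hornerE subrK.
rewrite fg expr1 hornerM !hornerE normrM ler_wpM2r //.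
have -> : g.[s] = g.[z] + h.[s] * (s - z).
  by have := congr1 (fun r => r.[s]) hh; rewrite !hornerE => <-; rewrite addrC subrK.
apply: le_trans (lerB_normD _ _); rewrite -/G lerBrDr -lerBrDl.
have -> : G - G / 2 = G / 2 by rewrite {1}(splitr G) addrK.
rewrite normrM; apply: (@le_trans _ _ (M * (G / (G + 2 * M)))).
  by apply: ler_pM.
rewrite mulrA ler_pdivrMr // mulrDr.
have -> : G / 2 * (2 * M) = M * G by rewrite mulrA divfK ?pnatr_eq0 // mulrC.
by rewrite lerDr mulr_ge0 ?divr_ge0 // ltW.
Qed.

End InterpolationBound.

(** * The subspace framework *)

Section ComplexNorms.
Variable R : realType.

Lemma cmodE (z : R[i]) : (cmod z)%:C = `|z|.
Proof. by rewrite normc_def /cmod; case: z => a b /=. Qed.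

Lemma cmod_ge0 (z : R[i]) : 0 <= cmod z.
Proof. by rewrite -lecR cmodE normr_ge0. Qed.

Lemma sqrt_sum_sqr_le (I : Type) (r : seq I) (f : I -> R) :
  (forall i, 0 <= f i) ->
  Num.sqrt (\sum_(i <- r) f i ^+ 2) <= \sum_(i <- r) f i.
Proof.
move=> f0; have S0 (s : seq I) : 0 <= \sum_(i <- s) f i by exact: sumr_ge0.
rewrite -[leRHS]ger0_norm // -sqrtr_sqr ler_wsqrtr //.
elim: r => [|i r IH]; first by rewrite !big_nil expr0n.
rewrite !big_cons sqrrD -addrA lerD2l (le_trans IH) // lerDr.
by rewrite mulrn_wge0 ?mulr_ge0.
Qed.

(** Transfers the lower bound [beta] on the spectral norm to the entrywise sum. Entries of a vector
    in the unit ball have modulus at most 1, and the Euclidean norm is at most the l1 norm. *)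
Lemma spectral_norm_le k l (M : 'M[R[i]]_(k, l)) :
  spectral_norm M <= \sum_i \sum_j cmod (M i j).
Proof.
have fcol s (x : 'cV[R[i]]_s) :
    frobenius_norm x = Num.sqrt (\sum_i cmod (x i 0) ^+ 2).
  by congr Num.sqrt; apply: eq_bigr => i _; rewrite big_ord1.
apply: ge_sup.
  (* The zero vector shows that the set under the supremum is nonempty. *)
  exists (frobenius_norm (M *m (0 : 'cV_l))), 0 => //=.
  rewrite fcol big1 ?sqrtr0 // => i _.
  by rewrite mxE /cmod ComplexField.Normc.normc0 expr0n.
move=> _ [x /= hx <-].
have x1 j : cmod (x j 0) <= 1.
  apply: le_trans hx; rewrite fcol -[leLHS]ger0_norm ?cmod_ge0 // -sqrtr_sqr.
  rewrite ler_wsqrtr // (bigD1 j) //= lerDl.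
  by apply: sumr_ge0 => i _; rewrite sqr_ge0.
rewrite fcol; apply: le_trans (sqrt_sum_sqr_le _ _) _ => [i|]; first exact: cmod_ge0.
apply: ler_sum => i _; rewrite -lecR cmodE mxE.
apply: le_trans (ler_norm_sum _ _ _) _.
rewrite rmorph_sum; apply: ler_sum => j _ /=.
by rewrite cmodE normrM ler_piMr // -cmodE -[1]/(1%:C) lecR.
Qed.

(** The diagonal entry [(j, j)] of [V ^t* *m V] is the sum of the squared moduli in column [j]. *)
Lemma orthonormal_columns_le1 n k (V : 'M[R[i]]_(n, k)) :
  orthonormal_columns V -> forall i j, `|V i j| <= 1.
Proof.
move=> hV i j; rewrite -(@expr_le1 _ 2) //.
have /matrixP/(_ j j) := hV; rewrite !mxE eqxx mulr1n => <-.
rewrite (bigD1 i) //= !mxE mulrC -normCK lerDl.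
by apply: sumr_ge0 => h _; rewrite !mxE mulrC -normCK exprn_ge0.
Qed.

Lemma orthonormal_columns_dim n k (V : 'M[R[i]]_(n, k)) :
  orthonormal_columns V -> (k <= n)%N.
Proof.
move=> hV; rewrite -[leqLHS](@mxrank1 R[i]) -hV.
exact: leq_trans (mxrankM_maxr _ _) (rank_leq_row _).
Qed.

End ComplexNorms.

(** * Moments of order 0 and 1 in the projection spaces *)

Section Subspaces.
Variables (R : realType) (n m p : nat).
Variables (A E : 'M[R[i]]_n) (B : 'M[R[i]]_(n, m)) (C : 'M[R[i]]_(p, n)).
Variables (q : nat) (mu : R[i]).
Hypotheses (hq : (1 <= q)%N) (hmu : ~ pencil_eigenvalue A E mu).

Local Lemma pencil_unit : A - mu *: E \in unitmx.
Proof. by rewrite unitmxE unitfE; apply/eqP. Qed.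

(** With [G = resolvent A E mu], the terms of index 0 and 1 are [G *m B] and [G *m E *m G *m B]. As
    [mu *: E - A] is minus the inverse of [G], the solutions are [- (G *m B)] and
    [G *m E *m G *m B]. *)
Lemma right_sum_moments d (V : 'M[R[i]]_(n, d)) :
    (right_sum A E B q mu 1%:M <= V^T)%MS ->
  exists x y, (mu *: E - A) *m (V *m x) = B /\
              (mu *: E - A) *m (V *m y) = E *m (V *m x).
Proof.
move=> hV.
have moment (i : 'I_q.+1) : exists x,
    V *m x = (resolvent A E mu *m E) ^+ i *m resolvent A E mu *m B.
  have /submxP[x hx] := submx_trans (sumsmx_sup i isT (submx_refl _)) hV.
  have : (<<((resolvent A E mu *m E) ^+ i *m resolvent A E mu *m B *m 1%:M)^T>>
          <= V^T)%MS by rewrite hx submxMl.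
  rewrite genmxE mulmx1 => /submxP[z /(congr1 trmx)].
  by rewrite trmxK trmx_mul trmxK => ->; exists z^T.
have [x0 hx0] := moment ord0; have [y0 hy0] := moment (Ordinal (hq : 1 < q.+1)%N).
rewrite expr0 -[1]/(1%:M) mul1mx in hx0; rewrite expr1 in hy0.
exists (- x0), y0; rewrite !mulmxN hx0 hy0 -opprB !mulNmx opprK.
by rewrite /resolvent !mulmxA mulmxV ?pencil_unit // !mul1mx.
Qed.

Lemma left_sum_moments d (W : 'M[R[i]]_(n, d)) :
    (left_sum A E C q mu 1%:M <= W^T)%MS ->
  exists x y, x *m W^t* *m (mu *: E - A) = C /\
              y *m W^t* *m (mu *: E - A) = x *m W^t* *m E.
Proof.
move=> hW.
have moment (i : 'I_q.+1) : exists x,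
    x *m W^t* = C *m resolvent A E mu *m (E *m resolvent A E mu) ^+ i.
  have /submxP[x hx] := submx_trans (sumsmx_sup i isT (submx_refl _)) hW.
  have : (<<((C *m resolvent A E mu *m (E *m resolvent A E mu) ^+ i)^t* *m 1%:M)^T>>
          <= W^T)%MS by rewrite hx submxMl.
  rewrite genmxE mulmx1 => /submxP[z /(congr1 trmx)].
  rewrite trmxK [(z *m _)^T]trmx_mul trmxK => /(congr1 (fun M => M^t*)).
  (* Undoing the conjugate transpose leaves the entrywise conjugate of [z] as witness. *)
  by rewrite trmxCK => ->; exists (z^T^t*); rewrite trmx_mul map_mxM.
have [x0 hx0] := moment ord0; have [y0 hy0] := moment (Ordinal (hq : 1 < q.+1)%N).
rewrite expr0 -[1]/(1%:M) mulmx1 in hx0; rewrite expr1 in hy0.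
exists (- x0), y0; rewrite !mulNmx hx0 hy0 -opprB !mulmxN opprK.
by rewrite /resolvent -!mulmxA mulVmx ?pencil_unit // !mulmx1.
Qed.

End Subspaces.

(** * From the defect bound to quadratic convergence *)

Lemma pencil_poly_horner (R : realType) n (A E : 'M[R[i]]_n) (s : R[i]) :
  (pencil_poly A E).[s] = \det (A - s *: E).
Proof.
rewrite -/(horner_eval s _) -det_map_mx; congr (\det _).
by apply/matrixP => i j; rewrite !mxE /= /horner_eval !hornerE.
Qed.

Lemma normr_det_pencil_sub (R : realType) n (A E : 'M[R[i]]_n) (s : R[i]) :
  `|\det (s *: E - A)| = `|\det (A - s *: E)|.
Proof. by rewrite -opprB -scaleN1r detZ normrM normrX normrN1 expr1n mul1r. Qed.

(** Chaining gives [c * beta * x <= L * (x + y) ^+ 2 <= 2 * L * (x ^+ 2 + y ^+ 2)]. The smallness of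
    [x] bounds [2 * L * x ^+ 2] by half of the left-hand side. *)
Lemma quadratic_absorption (R : realFieldType) (c L x y t beta D : R) :
    0 < c -> 0 < beta -> 0 < L -> 0 <= x -> 0 <= t ->
    x <= c * beta / (4 * L) -> c * x <= D -> D * beta <= t ^+ 2 * L ->
    t <= x + y ->
  x <= 4 * L / (c * beta) * y ^+ 2.
Proof.
move=> c0 b0 L0 x0 t0; have cb0 : 0 < c * beta by rewrite mulr_gt0.
rewrite ler_pdivlMr ?mulr_gt0 // => hx hD hDb ht.
rewrite [leRHS]mulrAC ler_pdivlMr //.
have h1 : c * x * beta <= D * beta by rewrite ler_pM2r.
have h2 : t ^+ 2 <= (x + y) ^+ 2 by rewrite ler_sqr ?nnegrE //; lra.
have h3 : t ^+ 2 * L <= (x + y) ^+ 2 * L by rewrite ler_pM2r.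
have h4 : x * (x * (4 * L)) <= x * (c * beta) by rewrite ler_wpM2l.
have h5 : 0 <= L * (x - y) ^+ 2 by rewrite mulr_ge0 ?sqr_ge0 // ltW.
nra.
Qed.

Theorem theorem4p3 (R : realType) (n m p : nat) (hm : (m <= n)%N) (hp : (p <= n)%N)
  (A E : 'M[R[i]]_n) (B : 'M[R[i]]_(n, m)) (C : 'M[R[i]]_(p, n))
  (D : 'M[R[i]]_(p, m))
  (hAE : standing_assumptions A E)
  (lambda1 : R[i]) (hlambda1 : dominant_pole A E B C lambda1)
  (q : nat) (hq : ((if m == p then 1 else 2) <= q)%N)
  (hadj : C *m \adj (lambda1 *: E - A) *m B != 0)
  (hhess : hessian (objective A E B C) (plane_of_complex lambda1) \in unitmx)
  (beta : R) (hbeta : 0 < beta) :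
  exists delta K : R, [/\ 0 < delta, 0 < K &
    forall (mu : nat -> R[i]) (d : nat -> nat) (V W : forall l, 'M[R[i]]_(n, d l)),
    subspace_framework A E B C D q mu V W ->
    forall j : nat, (1 <= j)%N ->
    cmod (mu j - lambda1) <= delta ->
    cmod (mu j.+1 - lambda1) <= delta ->
    ~ pencil_eigenvalue A E (mu j) ->
    mu j *: ((W j) ^t* *m E *m V j) - (W j) ^t* *m A *m V j \in unitmx ->
    beta <= spectral_norm (C *m V j
              *m \adj (mu j.+1 *: ((W j) ^t* *m E *m V j) - (W j) ^t* *m A *m V j)
              *m ((W j) ^t* *m B)) ->
    cmod (lambda1 - mu j.+1) <= K * cmod (lambda1 - mu j) ^+ 2].
Proof.
have {}hq : (1 <= q)%N by case: (m == p) hq => // /ltnW.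
(* The constants obtained over the field [R[i]] are nonnegative, hence real; they are moved to
   [R]. *)
have toR (x : R[i]) : 0 <= x -> exists2 r : R, 0 <= r & x = r%:C.
  move=> x0; have xE := RRe_real (ger0_real x0).
  by exists (complex.Re x); rewrite // -lecR xE.
have [reg simple _] := hAE; have [_ /simple[_ mup1] _] := hlambda1.
have [cC [eC [cC0 eC0 hroot]]] := simple_root_lower_bound reg mup1.
have [c c0' cE] := toR _ (ltW cC0); have [e e0' eE] := toR _ (ltW eC0).
have c0 : 0 < c by rewrite -ltcR -cE.
have e0 : 0 < e by rewrite -ltcR -eE.
pose nE := mx_coef_norm (map_mx polyC E); pose nA := mx_coef_norm (map_mx polyC A).
(* This bounds the coefficients of [mu0 *: E - A] for every [mu0] within distance 1 of [lambda1]. *)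
have k0 : 0 <= (`|lambda1| + 1) * nE + nA.
  by rewrite addr_ge0 ?mulr_ge0 ?addr_ge0 ?mx_coef_norm_ge0.
have [LC LC0 hL] := hermite_defect_bound E B C k0.
have [L0 L00 LE] := toR _ LC0; pose L := L0 + 1.
have Lpos : 0 < L by rewrite ltr_wpDl.
have cb0 : 0 < c * beta by rewrite mulr_gt0.
(* [e] is the radius of the simple-root bound, [1 / 2] gives [|t| <= 1], and the last term allows
   the absorption. *)
exists (Num.min e (Num.min (1 / 2) (c * beta / (4 * L)))), (4 * L / (c * beta)).
split; first by rewrite !lt_min e0 !divr_gt0 ?mulr_gt0.
  by rewrite divr_gt0 ?mulr_gt0.
(* The index of the statement is now [j.+1]: [hfw j] puts the moments at [mu j.+1] into the bases of
   index [j.+1], and [hfw j.+1] makes [mu j.+2] a pole of that reduced system. *)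
move=> mu d V W [hON hfw] [//|j] _.
rewrite !le_min => /and3P[_ hmu2 _] /and3P[hmue hmu12 hmuK] hnev _ hbeta'.
have [hV hW] := hON j.+1.
have [_ /(_ hnev)[hVs hWs]] := hfw j.
have [[_ hpole _] _] := hfw j.+1.
set mu0 := mu j.+1 in hmu2 hnev hVs hWs *.
set mu1 := mu j.+2 in hmue hmu12 hmuK hbeta' hpole *.
have dist_sym z : cmod (lambda1 - z) = cmod (z - lambda1).
  by apply: (@complexI R); rewrite !cmodE distrC.
pose t := mu1 - mu0; pose K := mu0 *: E - A.
have KtE : K + t *: E = mu1 *: E - A.
  by rewrite /K /t scalerBl addrC addrA subrK.
have ht : cmod t <= cmod (mu1 - lambda1) + cmod (mu0 - lambda1).
  rewrite -lecR rmorphD /= !cmodE -[`|mu0 - _|]distrC.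
  by apply: le_trans (ler_normD _ _); rewrite addrA subrK.
have redE s : (W j.+1)^t* *m (s *: E - A) *m V j.+1
    = s *: ((W j.+1)^t* *m E *m V j.+1) - (W j.+1)^t* *m A *m V j.+1.
  by rewrite mulmxBr mulmxBl -scalemxAr -scalemxAl.
have hxy : (exists x y, K *m (V j.+1 *m x) = B /\
                        K *m (V j.+1 *m y) = E *m (V j.+1 *m x)) \/
           (exists x y, x *m (W j.+1)^t* *m K = C /\
                        y *m (W j.+1)^t* *m K = x *m (W j.+1)^t* *m E).
  (* The side is chosen so that its directions [P] are the identity, giving full matrix moments. *)
  have [mp|pm] := leqP m p.
    left; apply: (right_sum_moments hq hnev).
    move: hVs; rewrite /right_space mp => /andP[_]; apply: submx_trans.
    exact: addsmxSr.
  right; apply: (left_sum_moments hq hnev).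
  move: hWs; rewrite /left_space (ltnW pm) => /andP[_]; apply: submx_trans.
  exact: addsmxSr.
have hK : mx_coef_norm (map_mx polyC K) <= (`|lambda1| + 1) * nE + nA.
  rewrite map_mxB map_mxZ; apply: le_trans (mx_coef_normD _ _) _.
  rewrite mx_coef_normN lerD //; apply: le_trans (mx_coef_normZ _ _) _.
  rewrite ler_wpM2r ?mx_coef_norm_ge0 // coef_normC.
  rewrite -[mu0](subrK lambda1) addrC; apply: le_trans (ler_normD _ _) _.
  by rewrite lerD2l -cmodE -[1]/(1%:C) lecR; lra.
have ht1 : `|t| <= 1 by rewrite -cmodE -[1]/(1%:C) lecR; lra.
(* [mu1] is an eigenvalue of the reduced pencil; comparing moduli removes the sign between the two
   pencil conventions. *)
have hdet : \det ((W j.+1)^t* *m (K + t *: E) *m V j.+1) = 0.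
  apply/eqP; rewrite -normr_eq0 KtE redE normr_det_pencil_sub.
  by move: hpole; rewrite /pencil_eigenvalue => ->; rewrite normr0.
have V1 := orthonormal_columns_le1 hV.
have W1 i h : `|((W j.+1)^t*) i h| <= 1.
  by rewrite !mxE norm_conjC orthonormal_columns_le1.
have := hL _ _ _ _ _ (orthonormal_columns_dim hV) V1 W1 hK ht1 hxy hdet.
rewrite KtE redE LE => key.
rewrite !dist_sym.
apply: (@quadratic_absorption _ c L _ _ (cmod t) beta (cmod (\det (mu1 *: E - A))));
  rewrite ?cmod_ge0 //.
  rewrite -lecR rmorphM /= !cmodE -cE normr_det_pencil_sub -pencil_poly_horner.
  by apply: hroot; rewrite eE -cmodE lecR.
apply: (@le_trans _ _ (cmod t ^+ 2 * L0)); last first.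
  by rewrite ler_wpM2l ?sqr_ge0 // lerDl.
rewrite -lecR !rmorphM /= !cmodE; apply: le_trans key.
rewrite ler_wpM2l //.
apply: (@le_trans _ _ ((\sum_i \sum_h cmod ((C *m V j.+1
   *m \adj (mu1 *: ((W j.+1)^t* *m E *m V j.+1) - (W j.+1)^t* *m A *m V j.+1)
   *m ((W j.+1)^t* *m B)) i h))%:C)).
  by rewrite lecR; apply: le_trans hbeta' _; exact: spectral_norm_le.
rewrite rmorph_sum; apply: ler_sum => i _; rewrite rmorph_sum.
by apply: ler_sum => h _ /=; rewrite cmodE.
Qed.
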